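(* There exists a directed set $\mathcal A$, which is not a cardinal number, with $\operatorname{card}(\mathcal A)=\operatorname{cov}(\mathcal N)$, such that $\mathcal{ANM}_{\mathcal A}\setminus\mathcal{ND}_{\mathcal A}$ is strongly $\mathfrak c$-algebrable in $\left(\mathbb R^{[0,1]}\right)^{\mathcal A}$.
   Context: A directed set is a nonempty set $\mathcal A$ with a reflexive transitive relation $\le$ in which any two elements have an upper bound; $x_A\to x$ if for each neighbourhood $U$ of $x$ there is $A_0$ with $x_A\in U$ for $A\ge A_0$. $\left(\mathbb R^{[0,1]}\right)^{\mathcal A}$ is the commutative real algebra of nets of functions $[0,1]\to\mathbb R$ with indexwise addition, indexwise pointwise multiplication and scalar multiplication. $\lambda$ is Lebesgue measure, $\mathcal N$ the null subsets of $[0,1]$, $\operatorname{cov}(\mathcal N)$ the least size of a subfamily of $\mathcal N$ covering $[0,1]$. $\mathcal{ANM}_{\mathcal A}$: nets of Lebesgue measurable $f_A:[0,1]\to\mathbb R$ converging a.e. to a measurable $f$ but not converging in measure to $f$. $\mathcal{ND}_{\mathcal A}$: nets of Lebesgue measurable $f_A:[0,1]\to\mathbb R$ with some integrable $g$ satisfying $|f_A|\le g$ a.e. for all $A$, $f_A\to f$ a.e. for some integrable $f$, and $\int|f_A-f|\,d\lambda\not\to0$. A subset $S$ of a commutative algebra is strongly $\kappa$-algebrable if there is a set $X$ of $\kappa$ algebraically independent elements (no nonzero polynomial without constant term vanishes at distinct elements of $X$) such that every nonzero element of the algebra generated by $X$ (values of polynomials without constant term at elements of $X$) belongs to $S$.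 *)

(* Defs.v *)
From mathcomp Require Import all_boot all_algebra.
From mathcomp Require Import mpoly.
From mathcomp Require Import all_classical all_reals all_analysis.
Import GRing.Theory Num.Theory.
Set Implicit Arguments. Unset Strict Implicit. Unset Printing Implicit Defensive.
Local Open Scope classical_set_scope.
Local Open Scope ring_scope.

(** The Lebesgue (completed) measurable space on R: its measurable sets are the
    Lebesgue measurable sets, and [lam] is Lebesgue measure on them. *)
Definition LebT (R : realType) :=
  caratheodory_type (R:=R) ((wlength (R:=R) idfun)^*%mu).
Definition lam (R : realType) : set (LebT R) -> \bar R :=
  @completed_lebesgue_measure R.
Definition I01 (R : realType) : set (LebT R) := `[0, 1].
Arguments lam R : clear implicits.
Arguments I01 R : clear implicits.

Definition directed (A : Type) (le : A -> A -> Prop) : Prop :=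
  inhabited A /\ (forall a, le a a) /\
  (forall a b c, le a b -> le b c -> le a c) /\
  (forall a b, exists c, le a c /\ le b c).

Definition net_cvg (R : realType) (A : Type) (le : A -> A -> Prop)
  (u : A -> R) (l : R) : Prop :=
  forall e : R, 0 < e -> exists a0, forall a, le a0 a -> `|u a - l| < e.

(** Convergence of an extended-real net to 0 (used for integrals and measures,
    which are nonnegative). *)
Definition net_cvg0e (R : realType) (A : Type) (le : A -> A -> Prop)
  (u : A -> \bar R) : Prop :=
  forall e : R, 0 < e -> exists a0, forall a, le a0 a -> (u a < e%:E)%E.

(** A net of functions [0,1] -> R; functions are represented as R -> R and only
    their values on [0,1] matter for the notions below. *)
Definition fnet (R : realType) (A : Type) := A -> R -> R.

Definition net_ae_cvg (R : realType) (A : Type) (le : A -> A -> Prop)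
  (F : fnet R A) (f : R -> R) : Prop :=
  \forall t \ae (lam R), I01 R t -> net_cvg le (fun a => F a t) (f t).

Definition net_cvg_in_measure (R : realType) (A : Type) (le : A -> A -> Prop)
  (F : fnet R A) (f : R -> R) : Prop :=
  forall e : R, 0 < e ->
    net_cvg0e le (fun a => lam R [set t | I01 R t /\ e <= `|F a t - f t|]).

Definition lmeas (R : realType) (f : R -> R) : Prop :=
  measurable_fun (I01 R) (f : LebT R -> R).

Definition lintegrable (R : realType) (f : R -> R) : Prop :=
  (lam R).-integrable (I01 R) (EFin \o (f : LebT R -> R)).

Definition ANM (R : realType) (A : Type) (le : A -> A -> Prop) (F : fnet R A)
  : Prop :=
  (forall a, lmeas (F a)) /\
  exists f : R -> R, lmeas f /\ net_ae_cvg le F f /\ ~ net_cvg_in_measure le F f.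

Definition ND (R : realType) (A : Type) (le : A -> A -> Prop) (F : fnet R A)
  : Prop :=
  (forall a, lmeas (F a)) /\
  (exists g : R -> R, lintegrable g /\
     forall a, \forall t \ae (lam R), I01 R t -> `|F a t| <= g t) /\
  exists f : R -> R, lintegrable f /\ net_ae_cvg le F f /\
    ~ net_cvg0e le (fun a =>
        (\int[lam R]_(t in I01 R) (`|F a t - f t|)%:E)%E).

Definition peval (R : realType) (A : Type) (n : nat) (P : mpoly.mpoly n R)
  (y : 'I_n -> fnet R A) : fnet R A :=
  fun a t => mpoly.meval (fun i => y i a t) P.

Definition fnet_eq (R : realType) (A : Type) (F G : fnet R A) : Prop :=
  forall a t, 0 <= t <= 1 -> F a t = G a t.

(** Strong kappa-algebrability with kappa = c = card R: X is the image of an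
    injective (modulo fnet_eq) family x : R -> fnet R A; polynomials have no
    constant term. *)
Definition strongly_c_algebrable (R : realType) (A : Type)
  (S : fnet R A -> Prop) : Prop :=
  exists x : R -> fnet R A,
    (forall r s, fnet_eq (x r) (x s) -> r = s) /\
    (forall (n : nat) (P : mpoly.mpoly n R) (s : 'I_n -> R),
        P != 0 -> mpoly.mcoeff mpoly.mnm0 P = 0 -> injective s ->
        ~ fnet_eq (peval P (fun i => x (s i))) (fun _ _ => 0)) /\
    (forall (n : nat) (P : mpoly.mpoly n R) (s : 'I_n -> R),
        mpoly.mcoeff mpoly.mnm0 P = 0 ->
        ~ fnet_eq (peval P (fun i => x (s i))) (fun _ _ => 0) ->
        S (peval P (fun i => x (s i)))).

(** (A, le) is a cardinal number with its natural order: a well-order (total,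
    antisymmetric, well-founded) every proper initial segment of which has
    cardinality strictly smaller than A (no injection of A into it). *)
Definition is_cardinal_order (A : Type) (le : A -> A -> Prop) : Prop :=
  (forall a b, le a b -> le b a -> a = b) /\
  (forall a b, le a b \/ le b a) /\
  well_founded (fun a b => le a b /\ a <> b) /\
  (forall b, ~ exists f : A -> A,
      (forall a, le (f a) b /\ f a <> b) /\ (forall a a', f a = f a' -> a = a')).

Definition null01 (R : realType) (N : set R) : Prop :=
  N `<=` `[0, 1] /\ (lam R).-negligible (N : set (LebT R)).

Definition card_eq_covN (R : realType) (A : Type) : Prop :=
  (exists F : A -> set R, (forall a, null01 (F a)) /\
      `[0, 1] `<=` \bigcup_a F a) /\
  (forall C : set (set R), (forall N, C N -> null01 N) ->
      `[0, 1] `<=` \bigcup_(N in C) N ->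
      exists f : A -> set R, (forall a, C (f a)) /\
        (forall a a', f a = f a' -> a = a')).

(* Main.v *)
Require Import Defs.
From Stdlib Require List.
From mathcomp Require Import all_boot all_order all_algebra.
From mathcomp Require Import mpoly.
From mathcomp Require Import all_classical all_reals all_analysis measurable_realfun.
Import Order.TTheory GRing.Theory Num.Theory.
Set Implicit Arguments. Unset Strict Implicit. Unset Printing Implicit Defensive.

(** Let (N_i)_{i in I} be a null cover of [0,1] of least cardinality, and let D
    be the countable set of finite lists of pairs (rational interval, natural
    number), each list being read as the step function [step d] on R.  Take
    A = seq I * D, preordered by inclusion of the finite subsets of I alone; D
    carries the indiscrete preorder, so A is not antisymmetric, hence not a
    cardinal.  As I is infinite, |seq I| = |I|, so card A = cov(N).

    The generators are the nets x_r(s, d) = step d r off the null set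
    U_{i in s} N_i, and 0 on it.  A polynomial P without constant term in
    x_{r_1}, ..., x_{r_n} takes the value c(d) = P(step d r_1, ..., step d r_n)
    off U_{i in s} N_i and 0 on it, so it converges to 0 everywhere on [0,1].
    If c is not identically 0, then c is unbounded, because D is closed under
    multiplication by naturals; this excludes both convergence in measure and
    domination.  If P is nonzero and the r_i are distinct, c is not identically
    0, because step functions interpolate any naturals at r_1, ..., r_n. *)

Local Open Scope classical_set_scope.

(** * Cardinality *)

Definition injects {T U : Type} (A : set T) (B : set U) : Prop :=
  exists2 f : T -> U, (forall x, A x -> B (f x)) &
    forall x y, A x -> A y -> f x = f y -> x = y.

(* The minimum is found by applying Zorn's lemma to sets of choice functions on
   which every evaluation map is injective: if no evaluation map were onto, a
   maximal such set could be enlarged by a function missing all the images. *)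
Lemma injects_min (T U : Type) (D : set T) (A : T -> set U) :
  D !=set0 -> exists2 i, D i & forall j, D j -> injects (A i) (A j).
Proof.
move=> [i0 Di0].
pose P (S : set (T -> U)) := (forall h i, S h -> D i -> A i (h i)) /\
  (forall h h' i, S h -> S h' -> D i -> h i = h' i -> h = h').
have [|S [[SA Sinj] Smax]] := @Zorn_bigcup _ P.
  move=> F FP Ftot; split.
    by move=> h i [S FS Sh] Di; exact: (FP _ FS).1.
  move=> h h' i [S FS Sh] [S' FS' Sh'] Di.
  have [SS|SS] := Ftot _ _ FS FS'.
    by apply: (FP _ FS').2 => //; exact: SS.
  by apply: (FP _ FS).2 => //; exact: SS.
have [[i Di isurj]|nsurj] := pselect (exists2 i, D i &
    forall x, A i x -> exists2 h, S h & h i = x).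
  exists i => // j Dj.
  have [[x0 /isurj[h0 Sh0 _]]|nU] := pselect (exists x, A i x); last first.
    by exists id => [x Aix|x y Aix]; case: nU; exists x.
  (* [k x] passes through [x] at [i]. Its value at [j] determines it, hence determines [x]. *)
  have /choice[k kP] : forall x, exists h, S h /\ (A i x -> h i = x).
    move=> x; have [/isurj[h Sh hx]|nx] := pselect (A i x); first by exists h.
    by exists h0.
  exists (fun x => k x j) => [x Aix|x y Aix Aiy kxy].
    by apply: SA => //; exact: (kP x).1.
  have := Sinj _ _ j (kP x).1 (kP y).1 Dj kxy.
  by move=> e; rewrite -[x](kP x).2// -[y](kP y).2// e.
have ngood i : exists x, D i -> A i x /\ (forall h, S h -> h i <> x).
  have [Di|] := pselect (D i); last first.
    (* An empty [U] would make evaluation at [i0] vacuously onto. *)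
    have [[x]|nU] := pselect (exists x : U, True); first by exists x.
    case: nsurj; exists i0 => // x; by case: nU; exists x.
  apply: contrapT => H; apply: nsurj; exists i => // x Aix.
  apply: contrapT => H'; apply: H; exists x => _; split => // h Sh hx.
  by apply: H'; exists h.
have [g gP] := choice ngood.
case: (Smax (S `|` [set g])).
  split; first exact: subsetUl.
  move=> /(_ g (or_intror erefl)) Sg.
  by have [_ /(_ g Sg)] := gP _ Di0.
split.
  by move=> h i [Sh|->] Di; [exact: SA|exact: (gP _ Di).1].
move=> h h' i [Sh|->] [Sh'|->] Di //.
- exact: Sinj.
- by move=> e; case: ((gP _ Di).2 _ Sh e).
- by move=> e; case: ((gP _ Di).2 _ Sh' (esym e)).
Qed.

Lemma injects_total (T : Type) (A B : set T) : injects A B \/ injects B A.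
Proof.
have [[] _ H] := @injects_min bool T setT (fun b => if b then A else B)
  (ex_intro _ true I); by [left; exact: (H false)|right; exact: (H true)].
Qed.

Lemma map_inj_in_setT (T U : Type) (A : set T) (f : T -> U) (s t : seq T) :
  (forall x y, A x -> A y -> f x = f y -> x = y) ->
  (forall x, List.In x s -> A x) -> (forall x, List.In x t -> A x) ->
  map f s = map f t -> s = t.
Proof.
move=> finj; elim: s t => [|x s IH] [|y t] //= As At [fxy fst].
congr cons; first by apply: finj => //; [apply: As; left|apply: At; left].
by apply: IH => // z zs; [apply: As; right|apply: At; right].
Qed.

(* [G] is the graph of an injection into [Y] of the nonempty lists over [Y]. *)
Record list_coding (X : Type) (G : set (seq X * X)) (Y : set X) : Prop := {
  coding_sub : forall s y, G (s, y) ->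
    [/\ s <> [::], forall x, List.In x s -> Y x & Y y];
  coding_tot : forall s, s <> [::] -> (forall x, List.In x s -> Y x) ->
    exists y, G (s, y);
  coding_fun : forall s y y', G (s, y) -> G (s, y') -> y = y';
  coding_inj : forall s s' y, G (s, y) -> G (s', y) -> s = s' }.

(** The base is read off the union itself: the elements whose singleton list has a code. A nonempty
    finite list over it already lies over the base of one member of the chain. *)
Lemma list_coding_bigcup (X : Type) (F : set (set (seq X * X))) :
  (forall G, F G -> exists Y, list_coding G Y) -> total_on F subset ->
  exists Y, list_coding (\bigcup_(G in F) G) Y.
Proof.
move=> FP Ftot.
have pair2 p q : (\bigcup_(G in F) G) p -> (\bigcup_(G in F) G) q ->
    exists2 G, F G & G p /\ G q.
  move=> [G FG Gp] [H FH Hq]; have [GH|HG] := Ftot _ _ FG FH.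
    by exists H => //; split=> //; exact: GH.
  by exists G => //; split=> //; exact: HG.
have mem G x : F G -> (exists2 Y, list_coding G Y & Y x) -> exists y, G ([:: x], y).
  move=> FG [Y GY Yx].
  by apply: (coding_tot GY) => // z /= [<-|//].
exists [set x | exists y, (\bigcup_(G in F) G) ([:: x], y)]; split.
- move=> s y [G FG Gsy]; have [Y GY] := FP _ FG.
  have [s0 sY Yy] := coding_sub GY Gsy; split=> //=.
    move=> x /sY Yx; have [z Gz] := mem _ x FG (ex_intro2 _ _ Y GY Yx).
    by exists z, G.
  have [z Gz] := mem _ y FG (ex_intro2 _ _ Y GY Yy).
  by exists z, G.
- move=> s s0 sY.
  suff [G FG Gs] : exists2 G, F G &
      forall x, List.In x s -> exists y, G ([:: x], y).
    have [Y GY] := FP _ FG.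
    have [|y Gy] := coding_tot GY s0.
      move=> x /Gs[y /(coding_sub GY)[_ + _]]; apply; by left.
    by exists y, G.
  elim: s s0 sY => [//|x [|x' s] IH] _ sY.
    have [y [G FG Gx]] := sY x (or_introl erefl).
    by exists G => // z [<-|//]; exists y.
  have [//|z zs|G FG Gs] := IH; first by apply: sY; right.
  have [y [H FH Hx]] := sY x (or_introl erefl).
  have [GH|HG] := Ftot _ _ FG FH.
    exists H => // z [<-|/Gs[w Gw]]; [by exists y|].
    by exists w; exact: GH.
  exists G => // z [<-|/Gs[w Gw]]; [|by exists w].
  by exists y; exact: HG.
- move=> s y y' Uy Uy'; have [G FG [Gy Gy']] := pair2 _ _ Uy Uy'.
  by have [Y GY] := FP _ FG; exact: (coding_fun GY Gy Gy').
- move=> s s' y Uy Uy'; have [G FG [Gy Gy']] := pair2 _ _ Uy Uy'.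
  by have [Y GY] := FP _ FG; exact: (coding_inj GY Gy Gy').
Qed.

Lemma list_codingP (X : Type) (G : set (seq X * X)) (Y : set X) (x0 : X) :
  list_coding G Y -> exists g : seq X -> X,
  (forall s, s <> [::] -> (forall x, List.In x s -> Y x) -> G (s, g s)).
Proof.
move=> GY.
suff /choice[g gP] : forall s, exists y, s <> [::] ->
    (forall x, List.In x s -> Y x) -> G (s, y) by exists g.
move=> s.
have [[s0 sY]|n] := pselect (s <> [::] /\ forall x, List.In x s -> Y x).
  by have [y Gy] := coding_tot GY s0 sY; exists y.
by exists x0 => s0 sY; case: n.
Qed.

(* If [Z] is a copy of [Y] outside [Y], then lists over [Y `|` Z] recode as
   lists over [Y]; the lists not already coded in [Y] get a code in [Z]. *)
Lemma list_coding_extend (X : Type) (G : set (seq X * X)) (Y : set X) (x0 : X) :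
  list_coding G Y -> Y x0 -> injects Y (~` Y) ->
  exists2 H, G `<` H & exists Z, list_coding H Z.
Proof.
move=> GY Yx0 [h hY hinj].
have [g gP] := list_codingP x0 GY.
have gY s : s <> [::] -> (forall x, List.In x s -> Y x) -> Y (g s).
  by move=> s0 sY; have [] := coding_sub GY (gP _ s0 sY).
have ginj s t : s <> [::] -> (forall x, List.In x s -> Y x) ->
    t <> [::] -> (forall x, List.In x t -> Y x) -> g s = g t -> s = t.
  move=> s0 sY t0 tY e; apply: (coding_inj GY (gP _ s0 sY)).
  by rewrite e; exact: gP.
pose Y' := Y `|` h @` Y.
(* [k] injects [Y'] into [Y]: [x] in [Y] goes to the code of [[:: x]], a copy [h y] to the code of
   [[:: y; y]]. The lengths keep the two cases apart. *)
have /choice[k kP] : forall x, exists z, (Y x -> z = g [:: x]) /\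
    (forall y, Y y -> x = h y -> z = g [:: y; y]).
  move=> x; have [Yx|nYx] := pselect (Y x).
    by exists (g [:: x]); split=> // y Yy xy; case: (hY _ Yy); rewrite -xy.
  have [[y Yy xy]|n] := pselect (exists2 y, Y y & x = h y).
    exists (g [:: y; y]); split=> // y' Yy' xy'.
    by have -> : y' = y by apply: hinj => //; rewrite -xy -xy'.
  by exists x0; split=> // y Yy xy; case: n; exists y.
have L1 x : Y x -> forall z, List.In z [:: x] -> Y z by move=> Yx z [<-|//].
have L2 x : Y x -> forall z, List.In z [:: x; x] -> Y z.
  by move=> Yx z [<-|[<-|//]].
have n1 (x : X) : [:: x] <> [::] by [].
have n2 (x : X) : [:: x; x] <> [::] by [].
have kY x : Y' x -> Y (k x).
  move=> [Yx|[y Yy yx]].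
    by rewrite (kP x).1//; apply: gY => //; exact: L1.
  by rewrite ((kP x).2 y)//; apply: gY => //; exact: L2.
have kinj x y : Y' x -> Y' y -> k x = k y -> x = y.
  move=> [Yx|[x' Yx' <-]] [Yy|[y' Yy' <-]].
  - rewrite (kP x).1// (kP y).1// => e.
    by have [] := ginj _ _ (n1 x) (L1 _ Yx) (n1 y) (L1 _ Yy) e.
  - rewrite (kP x).1// ((kP _).2 y')// => e.
    by have := ginj _ _ (n1 x) (L1 _ Yx) (n2 y') (L2 _ Yy') e.
  - rewrite ((kP _).2 x')// (kP y).1// => e.
    by have := ginj _ _ (n2 x') (L2 _ Yx') (n1 y) (L1 _ Yy) e.
  - rewrite ((kP _).2 x')// ((kP _).2 y')// => e.
    by have [->] := ginj _ _ (n2 x') (L2 _ Yx') (n2 y') (L2 _ Yy') e.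
have mk0 (s : seq X) : s <> [::] -> map k s <> [::] by case: s.
have mkY s : (forall x, List.In x s -> Y' x) ->
    forall x, List.In x (map k s) -> Y x.
  by move=> sY' x /List.in_map_iff[z [<- /sY']]; exact: kY.
pose H := G `|` [set p | [/\ p.1 <> [::], forall x, List.In x p.1 -> Y' x,
  ~ (forall x, List.In x p.1 -> Y x) & p.2 = h (g (map k p.1))]].
have nY : ~ Y (h x0) by exact: hY.
exists H.
  split; first exact: subsetUl.
  (* [[:: h x0]] has a code in [H] but none in [G], since [h x0] lies outside [Y]. *)
  move=> /(_ ([:: h x0], h (g (map k [:: h x0])))) HG.
  have [|_ + _] := coding_sub GY (HG _); last first.
    by move/(_ (h x0) (or_introl erefl)).
  right; split=> //=.
    by move=> x [<-|//]; right; exists x0.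
  by move/(_ (h x0) (or_introl erefl)).
exists Y'; split.
- move=> s y [Gsy|[/= s0 sY' _ ->]].
    have [s0 sY Yy] := coding_sub GY Gsy.
    by split=> //; [move=> x /sY; left|left].
  split=> //; right; eexists; last reflexivity.
  by apply: gY; [exact: mk0|exact: mkY].
- move=> s s0 sY'; have [sY|nsY] := pselect (forall x, List.In x s -> Y x).
    by exists (g s); left; exact: gP.
  by exists (h (g (map k s))); right.
- move=> s y y' [Gy|[/= s0 sY' nsY ->]] [Gy'|[/= s0' sY'' nsY' ->]] //.
  + exact: (coding_fun GY Gy Gy').
  + by have [_ sY _] := coding_sub GY Gy; case: nsY'.
  + by have [_ sY _] := coding_sub GY Gy'; case: nsY.
- move=> s s' y [Gy|[/= s0 sY' nsY yE]] [Gy'|[/= s0' sY'' nsY' yE']].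
  + exact: (coding_inj GY Gy Gy').
  + have [_ _] := coding_sub GY Gy; rewrite yE' => Yh; exfalso; move: Yh.
    by apply: hY; apply: gY; [exact: mk0|exact: mkY].
  + have [_ _] := coding_sub GY Gy'; rewrite yE => Yh; exfalso; move: Yh.
    by apply: hY; apply: gY; [exact: mk0|exact: mkY].
  + have e : g (map k s) = g (map k s').
      apply: hinj; last by rewrite -yE.
        by apply: gY; [exact: mk0|exact: mkY].
      by apply: gY; [exact: mk0|exact: mkY].
    apply: (map_inj_in_setT kinj sY' sY'').
    by apply: ginj e => //; [exact: mk0|exact: mkY|exact: mk0|exact: mkY].
Qed.

(** [pickle] codes the list of preimages. This first coding shows that a maximal one is nonempty. *)
Lemma list_coding_nat (X : Type) (j : nat -> X) : injective j ->
  exists G : set (seq X * X), list_coding G (range j).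
Proof.
move=> jinj.
have lift s : (forall x, List.In x s -> range j x) -> exists t, s = map j t.
  elim: s => [|x s IH] sj; first by exists [::].
  have [n _ <-] := sj x (or_introl erefl).
  by have [y ys|t ->] := IH; [apply: sj; right|exists (n :: t)].
exists [set p | p.1 <> [::] /\ exists2 t, p.1 = map j t & p.2 = j (pickle t)].
split.
- move=> s y [/= s0 [t st ->]]; split=> //; last by exists (pickle t).
  by rewrite st => x /List.in_map_iff[n [<- _]]; exists n.
- move=> s s0 /lift[t st]; exists (j (pickle t)); split=> //=.
  by exists t.
- move=> s y y' [/= _ [t st ->]] [_ [/= t' st' ->]].
  by have -> : t = t' by apply: (inj_map jinj); rewrite -st -st'.
- move=> s s' y [/= _ [t -> ->]] [_ [/= t' -> /jinj e]].
  by have -> : t = t' by apply: (pcan_inj (@pickleK _)).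
Qed.

(** Take a maximal coding, with base [Y]. By maximality [Y] does not inject into its complement, so
    the complement injects into [Y]. Hence [X] injects into the nonempty lists over [Y], and through
    their codes into [Y]. *)
Lemma inj_seq (X : Type) (j : nat -> X) : injective j ->
  exists f : seq X -> X, injective f.
Proof.
move=> jinj; have [G0 G0P] := list_coding_nat jinj.
have [|G [[Y GY] Gmax]] := @Zorn_bigcup _
  [set G : set (seq X * X) | exists Y, list_coding G Y].
  by move=> F FP Ftot; exact: list_coding_bigcup.
have [[s y] Gsy] : exists p, G p.
  apply: contrapT => nG; apply: (Gmax G0); last by exists (range j).
  split; first by move=> p Gp; case: nG; exists p.
  have [y Gy] := coding_tot G0P (s := [:: j 0]) ltac:(by [])
    ltac:(by move=> z [<-|//]; exists 0).
  by move/(_ _ Gy) => ?; apply: nG; exists ([:: j 0], y).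
have [_ _ Yy] := coding_sub GY Gsy.
have [YnY|[h hY hinj]] := injects_total Y (~` Y).
  have [H GH HP] := list_coding_extend GY Yy YnY.
  by case: (Gmax _ GH).
have [g gP] := list_codingP y GY.
have gY s' : s' <> [::] -> (forall x, List.In x s' -> Y x) -> Y (g s').
  by move=> s0 sY; have [] := coding_sub GY (gP _ s0 sY).
have ginj s' t : s' <> [::] -> (forall x, List.In x s' -> Y x) ->
    t <> [::] -> (forall x, List.In x t -> Y x) -> g s' = g t -> s' = t.
  move=> s0 sY t0 tY e; apply: (coding_inj GY (gP _ s0 sY)).
  by rewrite e; exact: gP.
pose c x := if pselect (Y x) then [:: x] else [:: h x; h x].
have c0 x : c x <> [::] by rewrite /c; case: pselect.
have cY x z : List.In z (c x) -> Y z.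
  rewrite /c; case: pselect => [Yx|nYx] /=; first by move=> [<-|].
  by have Yh := hY _ nYx; move=> [<-|[<-|]].
have cinj : injective c.
  move=> x x'; rewrite /c; case: pselect => Yx; case: pselect => Yx' //.
    by move=> [].
  by move=> [e _]; exact: hinj.
pose k x := g (c x).
have kinj : injective k.
  by move=> x x' /ginj e; apply: cinj; apply: e => //; exact: cY.
have kY x : Y (k x) by apply: gY => //; exact: cY.
have mkY s' z : List.In z (y :: map k s') -> Y z.
  by move=> [<-//|/List.in_map_iff[x [<- _]]].
(* The leading [y] gives the empty list a code too. *)
exists (fun s' => g (y :: map k s')) => s' t /ginj e.
have [] : y :: map k s' = y :: map k t.
  by apply: e => //; exact: mkY.
exact: inj_map.
Qed.

Local Open Scope ring_scope.

(** * Values of polynomials *)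

Local Notation widen := (widen_ord (leqnSn _)).

(** The naturals below [size p] are distinct in [R] and too many to be all roots. *)
Lemma poly_nat_nonroot (R : numDomainType) (p : {poly R}) :
  p != 0 -> exists k : nat, p.[k%:R] != 0.
Proof.
move=> p0; pose s := [seq k%:R : R | k <- iota 0 (size p)].
have us : uniq s by rewrite map_inj_uniq ?iota_uniq//; exact: mulrIn (oner_neq0 _).
have [/(max_poly_roots p0)/(_ us)|/allPn[_ /mapP[k _ ->]]] := boolP (all (root p) s).
  by rewrite size_map size_iota ltnn.
by exists k.
Qed.

(** This carries nonvanishing from [p] to a coefficient of [muni p], which is [p] read as a
    polynomial in its last variable. *)
Lemma coef_muni (R : comNzRingType) n (p : {mpoly R[n.+1]}) (m : 'X_{1..n.+1}) :
  (muni p)`_(m ord_max)@_[multinom m (widen i) | i < n] = p@_m.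
Proof.
rewrite muniE coef_sum raddf_sum /= [in RHS](mpolyE p) raddf_sum /=.
apply: eq_bigr => m' _; rewrite coefZ coefXn mcoeffZ mcoeffX.
have -> : (m' == m) = ([multinom m' (widen i) | i < n] ==
    [multinom m (widen i) | i < n]) && (m ord_max == m' ord_max).
  apply/eqP/andP => [->//|[/eqP/mnmP e /eqP e']].
  apply/mnmP => i; case: (unliftP ord_max i) => [j ->|->//].
  have := e j; rewrite !mnmE => /= e2.
  suff -> : lift ord_max j = widen j by [].
  by apply: val_inj; rewrite /= /bump leqNgt ltn_ord.
case: (m ord_max == _); last by rewrite mulr0 mcoeff0 andbF mulr0.
by rewrite mulr1 mcoeffZ mcoeffX andbT.
Qed.

Lemma meval_muni (R : comNzRingType) n (p : {mpoly R[n.+1]}) (v : 'I_n.+1 -> R) :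
  meval v p = (map_poly (meval (fun i => v (widen i))) (muni p)).[v ord_max].
Proof.
rewrite muniE mevalE rmorph_sum horner_sum; apply: eq_bigr => m _ /=.
rewrite map_polyZ /= hornerZ map_polyXn hornerXn mevalZ mevalX big_ord_recr /=.
rewrite -mulrA; congr (_ * (_ * _)).
by apply: eq_bigr => i _; rewrite mnmE.
Qed.

(** Induction on [n]: naturals for the first variables keep a coefficient of [muni p] nonzero, then
    one for the last variable avoids the roots. *)
Lemma meval_nat_neq0 (R : numDomainType) n (p : {mpoly R[n]}) :
  p != 0 -> exists v : 'I_n -> nat, meval (fun i => (v i)%:R) p != 0.
Proof.
elim: n p => [|n IH] p p0.
  exists (fun=> 0%N); move: p0; rewrite (nvar0_mpolyC p) mevalC.
  by apply: contraNN => /eqP ->; rewrite mpolyC0.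
have [m pm] : exists m, p@_m != 0.
  have : msupp p != [::] by rewrite msupp_eq0.
  by case E : (msupp p) => [//|m s] _; exists m; rewrite -mcoeff_msupp E mem_head.
have [|w wP] := IH (muni p)`_(m ord_max).
  by apply: contraNneq pm => e; rewrite -coef_muni e mcoeff0.
pose q := map_poly (meval (fun i => (w i)%:R)) (muni p).
have [|k kP] := @poly_nat_nonroot _ q.
  by apply: contraNneq wP => e; rewrite -coef_map /= -/q e coef0.
exists (fun i => if unlift ord_max i is Some j then w j else k).
rewrite meval_muni /= unlift_none; congr (_.[_] != 0) : kP.
apply: eq_map_poly => c; apply: meval_eq => i /=.
have -> : widen i = lift ord_max i.
  by apply: val_inj; rewrite /= /bump leqNgt ltn_ord.
by rewrite liftK.
Qed.

Lemma meval_const0 (R : comNzRingType) n (p : {mpoly R[n]}) (v : 'I_n -> R) :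
  p@_0%MM = 0 -> (forall i, v i = 0) -> meval v p = 0.
Proof.
move=> p0 v0; rewrite mevalE big1_seq// => m /andP[_ mp].
have [->|m0] := eqVneq m 0%MM; first by rewrite p0 mul0r.
have [i mi] : exists i, m i != 0%N.
  apply/existsP; apply: contraNT m0; rewrite negb_exists => /forallP H.
  by apply/eqP/mnmP => i; rewrite mnmE; apply/eqP; rewrite -[_ == _]negbK.
by rewrite (bigD1 i)//= v0 expr0n (negPf mi) mul0r mulr0.
Qed.

(** Induction on the Horner form: where [|p(x)| >= d] and [x >= (1 + |c|) / d], one has
    [|p(x) x + c| >= d x - |c| >= 1]. *)
Lemma poly_away_from0 (R : realFieldType) (p : {poly R}) : p != 0 ->
  exists d x0 : R, 0 < d /\ forall x, x0 <= x -> d <= `|p.[x]|.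
Proof.
elim/poly_ind: p => [|p c IH]; first by rewrite eqxx.
have [->|p0 _] := eqVneq p 0.
  rewrite mul0r add0r polyC_eq0 => c0; exists `|c|, 0; rewrite normr_gt0.
  by split=> // x _; rewrite hornerC.
have [d [x0 [d0 dP]]] := IH p0.
exists 1, (Num.max x0 ((1 + `|c|) / d)); split=> // x.
rewrite ge_max ler_pdivrMr// => /andP[/dP px xc].
rewrite hornerMXaddC; apply: le_trans (lerB_normD _ _).
rewrite lerBrDr (le_trans xc)// normrM mulrC.
rewrite ler_pM ?(ltW d0)// ?ler_norm//.
by rewrite -(pmulr_lge0 _ d0) (le_trans _ xc)// addr_ge0.
Qed.

(* Restrict [p] to the ray through [v]: it is a nonconstant polynomial in one
   variable. *)
Lemma meval_ray_unbounded (R : archiRealFieldType) n (p : {mpoly R[n]})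
    (v : 'I_n -> R) (M : R) :
  p@_0%MM = 0 -> meval v p != 0 ->
  exists k : nat, M <= `|meval (fun i => k%:R * v i) p|.
Proof.
move=> p0 pv.
pose q := \sum_(m <- msupp p) (p@_m * \prod_i v i ^+ m i) *: 'X^(mdeg m).
have qE x : q.[x] = meval (fun i => x * v i) p.
  rewrite /q horner_sum mevalE; apply: eq_bigr => m _.
  rewrite hornerZ hornerXn -mulrA; congr (_ * _).
  rewrite mdegE -prodrXr -big_split /=.
  by apply: eq_bigr => i _; rewrite exprMn mulrC.
have q0 : q.[0] = 0 by rewrite qE meval_const0// => i; rewrite mul0r.
have q1 : q.[1] != 0.
  by rewrite qE (meval_eq (v2 := v))// => i; rewrite mul1r.
(* So [q] is a nonzero [r] times the variable. As [|r| >= d] from [x0] on, [|q(k)| >= d k] there,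
   which is at least [M] once [k >= M / d]. *)
have /factor_theorem[r rE] : root q 0 by rewrite rootE q0.
have r0 : r != 0 by apply: contraNneq q1 => r0; rewrite rE r0 mul0r horner0.
have [d [x0 [d0 dP]]] := poly_away_from0 r0.
pose x := Num.max x0 (M / d).
exists (Num.bound `|x|); rewrite -qE rE hornerM subr0 hornerX normrM.
have xk : x <= (Num.bound `|x|)%:R.
  by rewrite ltW// (le_lt_trans (ler_norm _))// archi_boundP.
move: xk; rewrite ge_max ler_pdivrMr// => /andP[/dP dk Mk].
rewrite (le_trans Mk)// mulrC normr_nat ler_wpM2r//.
Qed.

(** * Step functions with rational breakpoints *)

(** Rational endpoints make the type of [d] countable. Intervals may overlap, and then their heights
    add up. *)
Definition step (R : realType) (d : seq (rat * rat * nat)) (r : R) : R :=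
  \sum_(p <- d) p.2%:R * (ratr p.1.1 < r < ratr p.1.2)%R%:R.

Lemma step_scale (R : realType) (k : nat) d (r : R) :
  step [seq (p.1, (k * p.2)%N) | p <- d] r = k%:R * step d r.
Proof.
by rewrite /step big_map mulr_sumr; apply: eq_bigr => p _; rewrite natrM mulrA.
Qed.

(** The finite list [l] stays at a positive distance from [r]; rationals closer than that exist on
    both sides. *)
Lemma isolating_rat_itv (R : realType) (r : R) (l : seq R) : r \notin l ->
  exists a b : rat, ratr a < r < ratr b /\
    forall x, x \in l -> ~~ (ratr a < x < ratr b).
Proof.
move=> rl; have [e e0 eP] : exists2 e, 0 < e & forall x, x \in l -> e <= `|x - r|.
  elim: l rl => [|y l IH]; first by exists 1.
  rewrite inE negb_or eq_sym => /andP[yr /IH[e e0 eP]].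
  exists (Num.min e `|y - r|); first by rewrite lt_min e0 normr_gt0 subr_eq0.
  by move=> x; rewrite inE ge_min => /predU1P[->|/eP ->//]; rewrite lexx orbT.
have [a] : exists q : rat, ratr q \in `]r - e, r[.
  by apply: rat_in_itvoo; rewrite ltrBlDr ltrDl.
have [b] : exists q : rat, ratr q \in `]r, r + e[.
  by apply: rat_in_itvoo; rewrite ltrDl.
rewrite !in_itv/= => /andP[rb be] /andP[ea ar].
exists a, b; rewrite ar rb; split=> // x /eP; apply: contraTN => /andP[ax xb].
by rewrite -ltNge ltr_distl (lt_trans ea ax) (lt_trans xb be).
Qed.

(** Each [s i] receives an interval of height [v i] that contains no other [s j]. *)
Lemma step_interpolation (R : realType) (n : nat) (s : 'I_n -> R) (v : 'I_n -> nat) :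
  injective s -> exists d, forall i, step d (s i) = (v i)%:R.
Proof.
move=> sinj.
have /choice[q qP] : forall i, exists q : rat * rat, forall j,
    (ratr q.1 < s j < ratr q.2) = (j == i).
  move=> i; have [|a [b [ab nab]]] :=
      @isolating_rat_itv R (s i) [seq s j | j <- enum 'I_n & j != i].
    by apply/mapP => -[j]; rewrite mem_filter => /andP[ji _] /sinj ij;
      rewrite ij eqxx in ji.
  exists (a, b) => j /=; have [->|ji] := eqVneq j i; first by rewrite ab.
  by apply/negbTE/nab/map_f; rewrite mem_filter ji mem_enum.
exists [seq (q i, v i) | i <- enum 'I_n] => i.
rewrite /step big_map big_enum /= (bigD1 i)//= qP eqxx mulr1 big1 ?addr0// => j ji.
by rewrite qP eq_sym (negPf ji) mulr0.
Qed.

(** * Nets vanishing on finite unions of null sets *)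

Section net.
Context (R : realType) (I D : Type) (N : I -> set R).

Definition list_union (s : seq I) : set R := [set t | exists2 i, List.In i s & N i t].

Definition incl_le (a b : seq I * D) : Prop :=
  forall i, List.In i a.1 -> List.In i b.1.

Definition vanishing_net (c : D -> R) : fnet R (seq I * D) :=
  fun a t => c a.2 * \1_(~` list_union a.1) t.

Lemma directed_incl_le (d : D) : directed incl_le.
Proof.
split; first by constructor; exact: ([::], d).
split; first by move=> a i.
split; first by move=> a b c ab bc i /ab /bc.
move=> a b; exists (a.1 ++ b.1, d); split=> i ai; apply/List.in_or_app;
  by [left|right].
Qed.

Hypothesis N0 : forall i, null01 (N i).

Lemma null_list_union s : null01 (list_union s).
Proof.
elim: s => [|i s [IH1 IH2]].
  have -> : list_union [::] = set0 by rewrite -subset0 => t [].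
  by split; [exact: sub0set|exact: negligible_set0].
have -> : list_union (i :: s) = N i `|` list_union s.
  apply/seteqP; split=> t.
    by move=> [j [<-|js] jt]; [left|right; exists j].
  by move=> [it|[j js jt]]; [exists i => //; left|exists j => //; right].
have [N1 N2] := N0 i; split; first by rewrite subUset.
exact: negligibleU.
Qed.

(** Null sets are measurable because [lam] is complete. *)
Lemma measurable_list_union s : measurable (list_union s : set (LebT R)).
Proof.
exact: (@completed_lebesgue_measure_is_complete R) (null_list_union s).2.
Qed.

Lemma measurable_I01 : measurable (I01 R).
Proof. by apply: sub_caratheodory; exact: measurable_itv. Qed.

Lemma lam_I01 : lam R (I01 R) = 1%E.
Proof.
transitivity (lebesgue_measure (`[0, 1] : set (measurableTypeR R))) => //.
by rewrite lebesgue_measure_itv /= lte01 oppr0 adde0.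
Qed.

Lemma lmeas_vanishing_net c a : lmeas (vanishing_net c a).
Proof.
apply: measurable_funM; first exact: measurable_cst.
apply: measurable_indic; apply: measurableC; exact: measurable_list_union.
Qed.

Lemma vanishing_net_in c a t : list_union a.1 t -> vanishing_net c a t = 0.
Proof. by move=> ut; rewrite /vanishing_net indicE memNset ?mulr0//=. Qed.

Lemma vanishing_net_notin c a t : ~ list_union a.1 t -> vanishing_net c a t = c a.2.
Proof. by move=> ut; rewrite /vanishing_net indicE mem_set ?mulr1. Qed.

(** If [t] lies in [N i], the net is exactly 0 at [t] from the index with list [[:: i]] on. *)
Lemma vanishing_net_cvg c t : inhabited D -> `[0, 1] `<=` \bigcup_i N i ->
  I01 R t -> net_cvg incl_le (fun a => vanishing_net c a t) 0.
Proof.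
move=> [d] Ncov /Ncov[i _ it] e e0; exists ([:: i], d) => a ia.
rewrite vanishing_net_in ?subr0 ?normr0//.
by exists i => //; apply: ia; left.
Qed.

Lemma ae_I01_nonempty (P : R -> Prop) :
  (\forall t \ae lam R, I01 R t -> P t) -> exists2 t, I01 R t & P t.
Proof.
move=> aeP; apply: contrapT => nP.
have : (lam R).-negligible (I01 R).
  by apply: negligibleS aeP => t It /= /(_ It) Pt; apply: nP; exists t.
move=> /(measure_negligible measurable_I01) lam0.
have : lam R (I01 R) = 0%E by [].
by rewrite lam_I01 => -[]/eqP; rewrite oner_eq0.
Qed.

Lemma lam_I01_diff s : lam R (I01 R `\` list_union s) = 1%E.
Proof.
rewrite /lam measureD; [|exact: measurable_I01|exact: measurable_list_union|].
  rewrite [X in (_ - X)%E]measure_negligible.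
  - by rewrite sube0; exact: lam_I01.
  - by apply: measurableI; [exact: measurable_I01|exact: measurable_list_union].
  - by apply: negligibleS (null_list_union s).2; exact: subIsetr.
by rewrite [X in (X < _)%E](_ : _ = 1%E) ?ltry//; exact: lam_I01.
Qed.

(** The order ignores [D], so above any [(s, d)] lies [(s, d1)] with [|c d1| >= 1]. There the net
    has absolute value at least 1 off a null set, that is, on a set of measure 1. *)
Lemma ANM_vanishing_net c : `[0, 1] `<=` \bigcup_i N i ->
  (forall M, exists d, M <= `|c d|) -> ANM incl_le (vanishing_net c).
Proof.
move=> Ncov cM; split; first exact: lmeas_vanishing_net.
have [d1 cd1] := cM 1.
exists (fun=> 0); split; first exact: measurable_cst.
split; first by apply: aeW => t It; apply: vanishing_net_cvg It.
move=> cv; have [[s d] sd] := cv 1 ltr01 1 ltr01.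
have := sd (s, d1) (fun i si => si); apply/negP.
rewrite -leNgt -(lam_I01_diff s); apply: le_measure; rewrite ?inE.
- by apply: measurableD; [exact: measurable_I01|exact: measurable_list_union].
- rewrite (_ : [set _ | _] = I01 R `\` list_union s).
    by apply: measurableD; [exact: measurable_I01|exact: measurable_list_union].
  apply/seteqP; split=> t [It tP]; split=> //.
    by move=> ut; move: tP; rewrite vanishing_net_in// subr0 normr0 ler10.
  by rewrite vanishing_net_notin// subr0.
- by move=> t [It nt]; split=> //; rewrite vanishing_net_notin// subr0.
Qed.

(** At indices with empty list the net is the constant [c d]. Countably many of them force a
    dominating [g] above every natural at almost every point. *)
Lemma not_ND_vanishing_net c :
  (forall M, exists d, M <= `|c d|) -> ~ ND incl_le (vanishing_net c).
Proof.
move=> cM [_ [[g [_ gP]] _]].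
have /choice[d dP] : forall n : nat, exists d, n%:R <= `|c d| by move=> n; exact: cM.
have : \forall t \ae lam R, forall n, I01 R t -> n%:R <= g t.
  apply: ae_foralln => n; apply: filterS (gP ([::], d n)) => t gt It.
  by rewrite (le_trans (dP n))// (le_trans _ (gt It))// vanishing_net_notin// => -[].
move=> H; have [t _ tP] : exists2 t, I01 R t & forall n, n%:R <= g t.
  by apply: ae_I01_nonempty; apply: filterS H => t tn It n; exact: tn.
have := tP (Num.bound `|g t|); apply/negP; rewrite -ltNge.
by rewrite (le_lt_trans (ler_norm _))// archi_boundP.
Qed.
End net.

(** * Null covers of the unit interval *)

Definition null_cover (R : realType) (C : set (set R)) : Prop :=
  (forall N, C N -> null01 N) /\ `[0, 1] `<=` \bigcup_(N in C) N.

Lemma null_cover_singletons (R : realType) :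
  null_cover [set [set t] | t in (`[0, 1] : set R)].
Proof.
split; last by move=> t It; exists [set t] => //; exists t.
move=> _ [t It <-]; split; first by move=> _ ->.
exists [set t]; split => //.
  by apply: sub_caratheodory; exact: measurable_set1.
by transitivity (lebesgue_measure ([set t] : set (measurableTypeR R)));
  last exact: lebesgue_measure_set1.
Qed.

(** A finite union of null sets is null, whereas [[0, 1]] is not. *)
Lemma infinite_null_cover (R : realType) (C : set (set R)) :
  null_cover C -> infinite_set C.
Proof.
move=> [C0 Ccov] /finite_seqP[s sC].
(* The default [set0] makes the family null at every index, as [null_list_union] requires. *)
have Cs0 (N : set R) : null01 (if N \in s then N else set0).
  case: ifPn => [Ns|_]; first by apply: C0; rewrite sC.
  by split; [exact: sub0set|exact: negligible_set0].
have In_mem (N : set R) : N \in s -> List.In N s.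
  by elim: (s) => // M s' IH; rewrite inE => /predU1P[->|/IH]; [left|right].
suff [t It] : exists2 t, I01 R t & False by [].
apply: ae_I01_nonempty; apply: negligibleS (null_list_union Cs0 s).2.
move=> t /= nt; have {nt} It : I01 R t by apply: contrapT => nI; apply: nt => /nI.
have [N CN Nt] := Ccov t It; have Ns : N \in s by move: CN; rewrite sC.
by exists N; [exact: In_mem|rewrite Ns].
Qed.

Lemma nat_inj_sig (T : pointedType) (C : set T) : infinite_set C ->
  exists j : nat -> {x | C x}, injective j.
Proof.
move=> /infiniteP/pcard_leP[f].
exists (fun n => exist _ (f n) (@funS _ _ _ _ f n I)) => m n.
by move=> /(congr1 sval)/= /inj; apply; rewrite inE.
Qed.

(** * Algebrability and the choice of the directed set *)

Lemma peval_vanishing_net (R : realType) (I D : Type) (N : I -> set R) n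
    (P : {mpoly R[n]}) (c : 'I_n -> D -> R) : P@_0%MM = 0 ->
  peval P (fun i => vanishing_net N (c i)) =
  vanishing_net N (fun d => meval (fun i => c i d) P).
Proof.
move=> P0; apply/funext => a; apply/funext => t.
have [ut|nut] := pselect (list_union N a.1 t).
  rewrite vanishing_net_in//; apply: meval_const0 => // i.
  by rewrite vanishing_net_in.
by rewrite vanishing_net_notin//; apply: meval_eq => i; rewrite vanishing_net_notin.
Qed.

Lemma step_separates (R : realType) (r s : R) :
  (forall d, step d r = step d s) -> r = s.
Proof.
move=> rs; apply/eqP/negP => /negP nrs.
have [|a [b [ab /(_ s)]]] := @isolating_rat_itv R r [:: s]; first by rewrite inE.
rewrite inE eqxx => /(_ isT) nab.
have := rs [:: (a, b, 1%N)]; rewrite /step !big_seq1 /= ab (negPf nab) !mul1r.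
by move/eqP; rewrite oner_eq0.
Qed.

Lemma strongly_c_algebrable_vanishing_net (R : realType) (I : Type)
    (N : I -> set R) : (forall i, null01 (N i)) -> `[0, 1] `<=` \bigcup_i N i ->
  strongly_c_algebrable (fun F : fnet R (seq I * seq (rat * rat * nat)) =>
    ANM (@incl_le I _) F /\ ~ ND (@incl_le I _) F).
Proof.
move=> N0 Ncov; exists (fun r => vanishing_net N (fun d => step d r)).
(* The union over the empty list is empty, so evaluation at the point 0 recovers [c d]. *)
have at0 (c : seq (rat * rat * nat) -> R) d :
    vanishing_net N c ([::], d) 0 = c d.
  by rewrite vanishing_net_notin// => -[].
have I0 : 0 <= (0 : R) <= 1 by rewrite lexx ler01.
split=> [r s rs|].
  by apply: step_separates => d; have := rs ([::], d) 0 I0; rewrite !at0.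
split=> [n P s P0 Pc sinj|n P s Pc nP]; rewrite peval_vanishing_net//.
  move=> /= H; have [v vP] := meval_nat_neq0 P0.
  have [d dP] := step_interpolation v sinj.
  have /eqP := H ([::], d) 0 I0; rewrite at0; apply/negP.
  by rewrite (meval_eq (v2 := fun i => (v i)%:R)).
set c := fun d => _.
have [d cd] : exists d, c d != 0.
  apply: contrapT => nc; apply: nP => a t _.
  have ca : c a.2 = 0 by apply/eqP/negPn/negP => ca; apply: nc; exists a.2.
  by rewrite peval_vanishing_net// -[LHS]/(c a.2 * _) ca mul0r.
have cM M : exists d, M <= `|c d|.
  (* Multiplying all heights of [d] by [k] moves the point with coordinates [step d (s i)] along its
     ray. *)
  have [k kM] := meval_ray_unbounded M Pc cd.
  exists [seq (p.1, (k * p.2)%N) | p <- d].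
  by rewrite /c (meval_eq (v2 := fun i => k%:R * step d (s i)))// => i;
    rewrite step_scale.
split; first exact: ANM_vanishing_net.
exact: not_ND_vanishing_net.
Qed.


Theorem mainTheorem3 (R : realType) :
  exists (A : Type) (le : A -> A -> Prop),
    directed le /\ ~ is_cardinal_order le /\ card_eq_covN R A /\
    strongly_c_algebrable (fun F : fnet R A => ANM le F /\ ~ ND le F).
Proof.
have [C C0 Cmin] := @injects_min _ _ (@null_cover R) id
  (ex_intro _ _ (@null_cover_singletons R)).
have [j jinj] := nat_inj_sig (infinite_null_cover C0).
have [f finj] := inj_seq jinj.
have N0 (i : {X | C X}) : null01 (sval i) by case: i => X CX; exact: C0.1.
have Ncov : `[0, 1] `<=` \bigcup_(i : {X | C X}) sval i.
  by move=> t /C0.2[X CX Xt]; exists (exist _ X CX).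
exists (seq {X | C X} * seq (rat * rat * nat))%type, (@incl_le _ _).
split; first exact: (directed_incl_le _ [::]).
split.
  move=> [anti _].
  by have := anti ([::], [::]) ([::], [:: (0, 0, 0%N)]) (fun _ => id) (fun _ => id).
split; last exact: strongly_c_algebrable_vanishing_net.
split.
  exists (fun a => list_union (fun i : {X | C X} => sval i) a.1).
  split; first by move=> a; exact: null_list_union.
  move=> t /Ncov[i _ it]; exists ([:: i], [::]) => //.
  by exists i => //; left.
move=> C' C'0 C'cov; have [g gC' ginj] := Cmin C' (conj C'0 C'cov).
(* A pair in [A] is coded as a two-entry list over the index type, which [f] sends back into that
   type; [g] then carries the cover [C] into [C']. *)
exists (fun a => g (sval (f [:: f a.1; j (pickle a.2)]))).
split; first by move=> a; apply: gC'; exact: svalP.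
move=> [s d] [s' d'] /= /ginj e.
have : f [:: f s; j (pickle d)] = f [:: f s'; j (pickle d')].
  apply: eq_sig_hprop; first by move=> ? ? ?; exact: Prop_irrelevance.
  by apply: e; exact: svalP.
by move=> /finj[/finj -> /jinj/(pcan_inj (@pickleK _)) ->].
Qed.
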